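(* Let $k \ge 2$ be an integer. There is a constant $C_k>0$ depending only on $k$ such that for all real numbers $x \ge 1$ and all real $y$ with $1 \le y \le x$, \[ Q_k(x+y) - Q_k(x) \le C_k\, \frac{y}{\log(y+1)}. \]
   Context: A positive integer $n$ is $k$-full if every prime $p$ dividing $n$ satisfies $p^k \mid n$ (i.e. every exponent in its prime factorization is at least $k$); $2$-full numbers are called squarefull. $Q_k(x)$ denotes the number of $k$-full positive integers $n \le x$. *)

(* Defs.v *)
From mathcomp Require Import all_boot.
From Stdlib Require Import Reals.

Definition kfull (k n : nat) : bool :=
  (0 < n) && all (fun p => p ^ k %| n) (primes n).

(* Q k x = #{ n : 1 <= n <= x, n k-full }.  Every such n satisfies
   n <= Z.to_nat (up x), so we count over that finite range. *)
Definition Q (k : nat) (x : R) : nat :=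
  count (fun n => kfull k n && (if Rle_dec (INR n) x then true else false)) (iota 1 (Z.to_nat (up x))).

(* Main.v *)
(** A [k]-full number with [k >= 2] is [2]-full, and a [2]-full number is never
    exactly divisible by a prime [p]: it avoids [p - 1] of the residue classes
    modulo [p ^ 2].  For each prime [p] let [v_p n] be [-1] if [p] exactly
    divides [n] and [h p = (p - 1) / (p ^ 2 - p + 1)] otherwise; modulo [p ^ 2]
    it has mean [0] and mean square [h p].  By the Chinese remainder theorem the
    products [v_d] of [v_p] over [p | d], for [d] squarefree, are almost
    orthogonal on intervals.  On [2]-full integers their sum over [d <= D] is the
    constant [H = \sum_d h d], so comparing second moments over an interval of
    [N] integers containing [S] such integers gives [S * H ^ 2 <= H * N + D ^ 6].
    Finally [H] is at least a constant times the harmonic sum up to [D], and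
    [D] is chosen as a power of two with [D ^ 7 <= N]. *)

From Stdlib Require Import ZArith Reals.
From Stdlib Require Lra.
From mathcomp Require Import all_boot all_order all_algebra.
From mathcomp Require Import lra ring zify.
Require Import Defs.

Import GRing.Theory Num.Theory Order.TTheory.
Local Open Scope ring_scope.

(** * Sums of periodic functions over intervals and over coprime moduli *)

Definition periodic (M : nat) (f : nat -> rat) := forall n, f (n %% M)%N = f n.

Lemma periodic_dvd (M P : nat) (f : nat -> rat) :
  (M %| P)%N -> periodic M f -> periodic P f.
Proof. by move=> MP fM n; rewrite -fM modn_dvdm // fM. Qed.

Lemma periodicD (M : nat) (f : nat -> rat) n :
  periodic M f -> f (n + M)%N = f n.
Proof. by move=> fM; rewrite -fM modnDr fM. Qed.

Lemma sum_period_shift (M : nat) (f : nat -> rat) a : periodic M f ->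
  \sum_(a <= i < a + M) f i = \sum_(0 <= i < M) f i.
Proof.
move=> fM; elim: a => [|a <-]; first by rewrite add0n.
have [->|M0] := posnP M; first by rewrite !addn0 !big_geq.
rewrite [RHS]big_ltn; last by rewrite -[X in (X < _)%N]addn0 ltn_add2l.
rewrite addSn big_nat_recr /=; last by rewrite -[X in (X < _)%N]addn0 ltn_add2l.
by rewrite periodicD // addrC.
Qed.

(** Full periods are peeled off and contribute exactly [mu * M] each. Fewer than [M] terms remain;
    since [f <= 1] they add at most [M], and [mu >= 0] keeps this below the stated bound. *)
Lemma sum_interval_le (M : nat) (f : nat -> rat) (mu : rat) a N :
    (0 < M)%N -> periodic M f -> (forall n, f n <= 1) -> 0 <= mu ->
    \sum_(0 <= i < M) f i = mu * M%:R ->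
  \sum_(a <= i < a + N) f i <= mu * N%:R + M%:R.
Proof.
move=> M0 fM f1 mu0 fE; elim/ltn_ind: N a => N IH a.
have [NM|MN] := ltnP N M.
  apply: (@le_trans _ _ N%:R).
    apply: le_trans (_ : \sum_(a <= i < a + N) 1 <= _); first exact: ler_sum.
    by rewrite sumr_const_nat addKn.
  have : N%:R <= M%:R :> rat by rewrite ler_nat ltnW.
  have : 0 <= mu * N%:R by rewrite mulr_ge0.
  by lra.
rewrite (@big_cat_nat _ _ _ (a + M)) ?leq_add2l ?leq_addr //=.
rewrite sum_period_shift // fE.
have -> : (a + N = a + M + (N - M))%N by lia.
have /IH/(_ (a + M)%N) : (N - M < N)%N by lia.
by rewrite natrB //; lra.
Qed.

(** By the Chinese remainder theorem, [i] modulo [a * b] corresponds to the pair of its residues, so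
    the sum factors. *)
Lemma sum_coprime_prod (a b : nat) (f g : nat -> rat) :
    (0 < a)%N -> (0 < b)%N -> coprime a b -> periodic a f -> periodic b g ->
  \sum_(0 <= i < a * b) f i * g i =
  (\sum_(0 <= i < a) f i) * (\sum_(0 <= i < b) g i).
Proof.
move=> a0 b0 ab fa gb; rewrite !big_mkord big_distrlr pair_big /=.
pose F (i : 'I_(a * b)) : 'I_a * 'I_b :=
  (Ordinal (ltn_pmod i a0), Ordinal (ltn_pmod i b0)).
have Finj : injective F.
  move=> i j [/eqP ija /eqP ijb]; apply/val_inj.
  have /eqP : i == j %[mod a * b] by rewrite chinese_remainder // ija ijb.
  by rewrite !modn_small.
have Fbij : bijective F.
  by apply: inj_card_bij => //; rewrite card_prod !card_ord.
rewrite [RHS](reindex F) /=; last exact: onW_bij.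
by apply: eq_bigr => i _; rewrite fa gb.
Qed.

Lemma periodic_prod (s : seq nat) (phi : nat -> nat -> rat) :
    (forall p, p \in s -> periodic (p ^ 2) (phi p)) ->
  periodic (\prod_(p <- s) p ^ 2)%N (fun n => \prod_(p <- s) phi p n).
Proof.
move=> phiP n; rewrite [LHS]big_seq [RHS]big_seq; apply: eq_bigr => p ps.
apply: (periodic_dvd _ _ _ _ (phiP p ps)).
by rewrite (big_rem p ps) dvdn_mulr.
Qed.

Lemma sum_prod_primes (s : seq nat) (phi : nat -> nat -> rat) :
    uniq s -> all prime s ->
    (forall p, p \in s -> periodic (p ^ 2) (phi p)) ->
  \sum_(0 <= n < \prod_(p <- s) p ^ 2) \prod_(p <- s) phi p n =
  \prod_(p <- s) \sum_(0 <= n < p ^ 2) phi p n.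
Proof.
elim: s => [|p s IH] /=; first by rewrite !big_nil big_nat1 big_nil.
move=> /andP[ps us] /andP[pp pr] phiP.
rewrite !big_cons; under eq_bigr do rewrite big_cons.
rewrite (@sum_coprime_prod _ _ (phi p) (fun n => \prod_(q <- s) phi q n)).
- by rewrite IH // => q qs; apply: phiP; rewrite inE qs orbT.
- by rewrite expn_gt0 prime_gt0.
- rewrite big_seq; apply: prodn_cond_gt0 => q qs.
  by rewrite expn_gt0 prime_gt0 // (allP pr).
- rewrite coprimeXl // big_seq.
  elim/big_ind: _ => [|x y|q qs]; [exact: coprimen1| |].
    by rewrite coprimeMr => -> ->.
  rewrite coprimeXr // prime_coprime // dvdn_prime2 //; last exact: (allP pr).
  by apply: contraNneq ps => ->.
- exact: (phiP p (mem_head p s)).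
- by apply: periodic_prod => q qs; apply: (phiP q); rewrite inE qs orbT.
Qed.

(** * Local weights modulo [p ^ 2] *)

Definition exactly_divides (p n : nat) : bool := (p %| n)%N && ~~ (p ^ 2 %| n)%N.

(** Modulo [p ^ 2], [p - 1] residues are exactly divisible by [p] and [p ^ 2 - p + 1] are not. This
    ratio is the value on the latter that balances [-1] on the former. *)
Definition sieve_density (p : nat) : rat :=
  (p%:R - 1) / (p%:R ^+ 2 - p%:R + 1).

Definition sieve_weight (p n : nat) : rat :=
  if exactly_divides p n then - 1 else sieve_density p.

Lemma sieve_denom_gt0 (p : nat) : 0 < (p%:R ^+ 2 - p%:R + 1 : rat).
Proof. by nra. Qed.

Lemma sieve_density_ge0 (p : nat) : (0 < p)%N -> 0 <= sieve_density p.
Proof.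
move=> p0; apply: divr_ge0; first by rewrite subr_ge0 ler1n.
exact/ltW/sieve_denom_gt0.
Qed.

Lemma sieve_density_le1 (p : nat) : sieve_density p <= 1.
Proof. by rewrite ler_pdivrMr ?sieve_denom_gt0 //; nra. Qed.

Lemma exactly_divides_mod (p n : nat) :
  exactly_divides p (n %% p ^ 2) = exactly_divides p n.
Proof.
by rewrite /exactly_divides /dvdn modn_mod modn_dvdm // dvdn_exp.
Qed.

Lemma sum_exactly_divides (p : nat) (A B : rat) : prime p ->
  \sum_(0 <= n < p ^ 2) (if exactly_divides p n then A else B) =
  (p%:R - 1) * A + (p%:R ^+ 2 - p%:R + 1) * B.
Proof.
move=> pp; have p0 := prime_gt0 pp.
(* The range is moved to start at 1, as in [divn_count_dvd], which counts multiples from 1 on. *)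
rewrite -(sum_period_shift _ _ 1); last by move=> n; rewrite exactly_divides_mod.
rewrite add1n.
have E n : (if exactly_divides p n then A else B) =
    B + (A - B) * (p %| n)%:R - (A - B) * (p ^ 2 %| n)%:R.
  rewrite /exactly_divides; have [pn|pn] := boolP (p %| n)%N => /=.
    by case: (_ %| _)%N => /=; ring.
  have /negPf -> : ~~ (p ^ 2 %| n)%N.
    by apply: contra pn; apply: dvdn_trans; rewrite dvdn_exp.
  by rewrite !(mulr0n, mulr0) addr0 subr0.
under eq_bigr do rewrite E.
rewrite sumrB big_split /= sumr_const_nat -!mulr_sumr -!natr_sum.
rewrite -!divn_count_dvd divnn expn_gt0 p0 /= -[X in (_ %/ X)%N]expn1.
rewrite -expnB // subSS subn0 expn1.
by ring.
Qed.

Lemma sieve_weight_periodic (p : nat) : periodic (p ^ 2) (sieve_weight p).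
Proof. by move=> n; rewrite /sieve_weight exactly_divides_mod. Qed.

Lemma sum_sieve_weight (p : nat) : prime p ->
  \sum_(0 <= n < p ^ 2) sieve_weight p n = 0.
Proof.
move=> pp; rewrite sum_exactly_divides // /sieve_density.
by have := sieve_denom_gt0 p => h; field; rewrite gt_eqF.
Qed.

Lemma sum_sieve_weight_sq (p : nat) : prime p ->
  \sum_(0 <= n < p ^ 2) sieve_weight p n ^+ 2 = sieve_density p * (p ^ 2)%:R.
Proof.
move=> pp; have E n : sieve_weight p n ^+ 2 =
    if exactly_divides p n then 1 else sieve_density p ^+ 2.
  by rewrite /sieve_weight; case: ifP => // _; rewrite sqrrN expr1n.
under eq_bigr do rewrite E.
rewrite sum_exactly_divides // natrX /sieve_density.
by have := sieve_denom_gt0 p => h; field; rewrite gt_eqF.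
Qed.

Lemma sieve_weight_norm (p n : nat) : (0 < p)%N -> `|sieve_weight p n| <= 1.
Proof.
move=> p0; rewrite /sieve_weight; case: ifP => _; first by rewrite normrN1.
by rewrite ger0_norm ?sieve_density_ge0 // sieve_density_le1.
Qed.

(** * Weights indexed by squarefree integers and their correlations *)

(** Being equal to its radical makes [d] recoverable from [primes d]. It also excludes 0, whose list
    of primes is empty. *)
Definition squarefree (d : nat) : bool := d == (\prod_(p <- primes d) p)%N.

Definition sieve_weight_prod (d n : nat) : rat :=
  \prod_(p <- primes d) sieve_weight p n.

Definition sieve_density_prod (d : nat) : rat :=
  \prod_(p <- primes d) sieve_density p.

Lemma primes_inj_squarefree (d e : nat) :
  squarefree d -> squarefree e -> primes d = primes e -> d = e.
Proof. by move=> /eqP dE /eqP eE H; rewrite dE H -eE. Qed.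

Lemma primes_prod_leq (d : nat) : (0 < d)%N -> (\prod_(p <- primes d) p <= d)%N.
Proof.
move=> d0; rewrite {2}(prod_prime_decomp d0) prime_decompE big_map /=.
rewrite !big_seq; apply: leq_prod => p; rewrite mem_primes => /and3P[pp _ pd].
by rewrite -{1}(expn1 p) leq_exp2l ?prime_gt1 // logn_gt0 mem_primes pp d0.
Qed.

Lemma sieve_density_prod_ge0 (d : nat) : 0 <= sieve_density_prod d.
Proof.
rewrite /sieve_density_prod big_seq; apply: prodr_ge0 => p.
by rewrite mem_primes => /andP[pp _]; rewrite sieve_density_ge0 // prime_gt0.
Qed.

Lemma sieve_density_prod_le1 (d : nat) : sieve_density_prod d <= 1.
Proof.
rewrite /sieve_density_prod big_seq; apply: prodr_ile1 => p.
rewrite mem_primes => /andP[pp _].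
by rewrite sieve_density_ge0 ?prime_gt0 // sieve_density_le1.
Qed.

Lemma sieve_weight_prod_norm (d n : nat) : `|sieve_weight_prod d n| <= 1.
Proof.
rewrite /sieve_weight_prod normr_prod big_seq; apply: prodr_ile1 => p.
rewrite mem_primes => /andP[pp _].
by rewrite normr_ge0 sieve_weight_norm ?prime_gt0.
Qed.

(** Padding with ones brings the products for [d] and [e] to the common index set
    [primes (d * e)]. *)
Lemma prod_primes_dvd (d m : nat) (f : nat -> rat) : (0 < m)%N -> (d %| m)%N ->
  \prod_(p <- primes d) f p =
  \prod_(p <- primes m) if p \in primes d then f p else 1.
Proof.
move=> m0 dm; rewrite -big_mkcond -[RHS]big_filter /=; apply: perm_big.
apply: uniq_perm; rewrite ?filter_uniq ?primes_uniq // => p.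
rewrite mem_filter; case: (boolP (p \in _)) => //=.
rewrite !mem_primes => /and3P[pp _ pd].
by rewrite pp m0 (dvdn_trans pd).
Qed.

(** The mean over a period factors over the primes of [d * e]. A prime dividing only one of [d], [e]
    gives a factor 0; if [d = e], each factor is the mean square [sieve_density p]. The error is the
    period, at most [(d * e) ^ 2]. *)
Lemma sieve_correlation (d e a N : nat) :
    (0 < d)%N -> (0 < e)%N -> squarefree d -> squarefree e ->
  \sum_(a <= n < a + N) sieve_weight_prod d n * sieve_weight_prod e n <=
  (if d == e then sieve_density_prod d else 0) * N%:R + ((d * e) ^ 2)%:R.
Proof.
move=> d0 e0 sd se; set m := (d * e)%N.
have m0 : (0 < m)%N by rewrite muln_gt0 d0.
have [dm em] : (d %| m)%N /\ (e %| m)%N by rewrite dvdn_mulr // dvdn_mull.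
pose phi p n : rat := (if p \in primes d then sieve_weight p n else 1) *
                      (if p \in primes e then sieve_weight p n else 1).
have E n : sieve_weight_prod d n * sieve_weight_prod e n =
    \prod_(p <- primes m) phi p n.
  by rewrite big_split /= /sieve_weight_prod (prod_primes_dvd d m) //
    (prod_primes_dvd e m).
have phiP p : p \in primes m -> periodic (p ^ 2) (phi p).
  by move=> _ n; rewrite /phi !sieve_weight_periodic.
have pr : all prime (primes m).
  by apply/allP => p; rewrite mem_primes => /andP[].
set P := (\prod_(p <- primes m) p ^ 2)%N.
have P0 : (0 < P)%N.
  rewrite /P big_seq; apply: prodn_cond_gt0 => p /(allP pr) pp.
  by rewrite expn_gt0 prime_gt0.
have Pm : (P <= m ^ 2)%N.
  have -> : P = ((\prod_(p <- primes m) p) ^ 2)%N.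
    by rewrite -mulnn -big_split /=; apply: eq_bigr => p _; rewrite mulnn.
  by rewrite leq_sqr primes_prod_leq.
under eq_bigr do rewrite E.
apply: (@le_trans _ _
  ((if d == e then sieve_density_prod d else 0) * N%:R + P%:R)); last first.
  by rewrite lerD2l ler_nat.
apply: sum_interval_le => //.
- exact: periodic_prod.
- by move=> n; rewrite -E (le_trans (ler_norm _)) // normrM mulr_ile1
    ?normr_ge0 ?sieve_weight_prod_norm.
- by case: eqP => // _; exact: sieve_density_prod_ge0.
rewrite sum_prod_primes ?primes_uniq //.
have [de|de] := eqVneq d e.
  have md : primes m = primes d.
    by apply/eq_primes => p; rewrite primesM // -de orbb.
  rewrite /P /sieve_density_prod md natr_prod -big_split /= !big_seq.
  apply: eq_bigr => p pd; rewrite -sum_sieve_weight_sq; last first.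
    by move: pd; rewrite mem_primes => /andP[].
  by apply: eq_bigr => n _; rewrite /phi -de pd expr2.
rewrite mul0r; apply/eqP; rewrite prodf_seq_eq0.
(* If no factor vanished, every prime of [d * e] would divide both [d] and [e], forcing [d = e]. *)
apply: contraNT de => /hasPn H; apply/eqP/primes_inj_squarefree => //.
apply/eq_primes => p; have [pm|] := boolP (p \in primes m); last first.
  by rewrite primesM // negb_or => /andP[/negPf-> /negPf->].
move: (H p pm) => /=; have := sum_sieve_weight p (allP pr p pm).
rewrite /phi; case: (p \in primes d); case: (p \in primes e) => // S.
  by under eq_bigr do rewrite mulr1; rewrite S eqxx.
by under eq_bigr do rewrite mul1r; rewrite S eqxx.
Qed.

(** * Squarefull numbers and the second moment inequality *)

(* [^] in the definition of [kfull] is [Nat.pow], not [expn]. *)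
Lemma Nat_powE (p k : nat) : Nat.pow p k = (p ^ k)%N.
Proof. by elim: k => //= k ->; rewrite multE expnS. Qed.

Lemma sieve_weight_kfull (p n : nat) :
  prime p -> kfull 2 n -> sieve_weight p n = sieve_density p.
Proof.
move=> pp /andP[n0 /allP Hn]; rewrite /sieve_weight /exactly_divides.
have [pn|//] := boolP (p %| n)%N.
by rewrite -Nat_powE Hn // mem_primes pp n0.
Qed.

Lemma sieve_weight_prod_kfull (d n : nat) :
  kfull 2 n -> sieve_weight_prod d n = sieve_density_prod d.
Proof.
move=> Hn; rewrite /sieve_weight_prod /sieve_density_prod !big_seq.
apply: eq_bigr => p; rewrite mem_primes => /andP[pp _].
exact: sieve_weight_kfull.
Qed.

Definition sieve_total (D : nat) : rat :=
  \sum_(1 <= d < D.+1 | squarefree d) sieve_density_prod d.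

Lemma sieve_bound (D a N : nat) :
  (count (kfull 2) (iota a N))%:R * sieve_total D ^+ 2 <=
  sieve_total D * N%:R + (D ^ 6)%:R.
Proof.
pose F n := \sum_(1 <= d < D.+1 | squarefree d) sieve_weight_prod d n.
(* Lower bound for the second moment: [F n] equals [sieve_total D] at squarefull [n], and the other
   squares are nonnegative. *)
apply: (@le_trans _ _ (\sum_(a <= n < a + N) F n ^+ 2)).
  rewrite -sum1_count natr_sum mulr_suml /index_iota addKn big_mkcond /=.
  apply: ler_sum => n _; case: ifP => Hn; last exact: sqr_ge0.
  rewrite mul1r /F /sieve_total.
  by under [X in _ <= X ^+ 2]eq_bigr do rewrite sieve_weight_prod_kfull //.
have -> : \sum_(a <= n < a + N) F n ^+ 2 =
    \sum_(1 <= d < D.+1 | squarefree d) \sum_(1 <= e < D.+1 | squarefree e)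
    \sum_(a <= n < a + N) sieve_weight_prod d n * sieve_weight_prod e n.
  under eq_bigr do rewrite expr2 big_distrlr /=.
  by rewrite exchange_big; apply: eq_bigr => d _; rewrite exchange_big.
apply: (@le_trans _ _ (\sum_(1 <= d < D.+1 | squarefree d)
    (sieve_density_prod d * N%:R + (D ^ 5)%:R))).
  rewrite big_nat_cond [leRHS]big_nat_cond.
  apply: ler_sum => d /andP[/andP[d0 dD] sd].
  (* Only [e = d] has a main term. Each pair has error at most [D ^ 4], hence [D ^ 5] for each [d]
     and [D ^ 6] in total. *)
  apply: (@le_trans _ _ (\sum_(1 <= e < D.+1 | squarefree e)
    ((if d == e then sieve_density_prod d * N%:R else 0) + (D ^ 4)%:R))).
    rewrite big_nat_cond [leRHS]big_nat_cond.
    apply: ler_sum => e /andP[/andP[e0 eD] se].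
    apply: le_trans (sieve_correlation d e a N d0 e0 sd se) _.
    have -> : (if d == e then sieve_density_prod d else 0) * N%:R =
        (if d == e then sieve_density_prod d * N%:R else 0).
      by case: ifP => // _; rewrite mul0r.
    by rewrite lerD2l ler_nat (@expnM D 2 2) leq_sqr -mulnn leq_mul.
  rewrite big_split /=; apply: lerD.
    rewrite big_mkcond (bigD1_seq d) ?iota_uniq ?mem_index_iota ?d0 //=.
    rewrite sd eqxx big1 ?addr0 // => e ed.
    by rewrite eq_sym (negPf ed); case: (squarefree e).
  apply: (@le_trans _ _ (\sum_(1 <= e < D.+1) (D ^ 4)%:R)).
    by rewrite big_mkcond; apply: ler_sum => e _; case: ifP.
  by rewrite sumr_const_nat subn1 /= -[leLHS]mulr_natr -natrM ler_nat -expnSr.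
rewrite big_split /= -mulr_suml; apply: lerD => //.
apply: (@le_trans _ _ (\sum_(1 <= e < D.+1) (D ^ 5)%:R)).
  by rewrite big_mkcond; apply: ler_sum => e _; case: ifP.
by rewrite sumr_const_nat subn1 /= -[leLHS]mulr_natr -natrM ler_nat -expnSr.
Qed.

(** * Logarithmic lower bound for [sieve_total] *)

(** If [n] is not squarefree, some prime has exponent at least 2; its square is split off and the
    quotient is treated by strong induction. *)
Lemma squarefree_decomp (n : nat) : (0 < n)%N ->
  exists a d, [/\ squarefree d, (0 < a)%N, (0 < d)%N & (n = a ^ 2 * d)%N].
Proof.
elim/ltn_ind: n => n IH n0.
have [sn|sn] := boolP (squarefree n); first by exists 1%N, n; rewrite mul1n.
have /hasP[p] : has (fun p => logn p n != 1%N) (primes n).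
  apply: contraNT sn => /hasPn H; apply/eqP.
  rewrite {1}(prod_prime_decomp n0) prime_decompE big_map /= !big_seq.
  by apply: eq_bigr => p /H /negPn/eqP ->; rewrite expn1.
rewrite -logn_gt0 => l0 l1; have pp : prime p.
  by move: l0; rewrite logn_gt0 mem_primes => /andP[].
have /dvdnP[q nE] : (p ^ 2 %| n)%N.
  by rewrite pfactor_dvdn //; case: (logn p n) l0 l1 => [|[|]].
have q0 : (0 < q)%N by move: n0; rewrite nE muln_gt0 => /andP[].
have p1 := prime_gt1 pp.
have [|a [d [sd a0 d0 qE]]] := IH q _ q0.
  by rewrite nE ltn_Pmulr // (@ltn_exp2l p 0).
exists (p * a)%N, d; split => //; first by rewrite muln_gt0 a0 prime_gt0.
by rewrite nE qE expnMn mulnC mulnA.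
Qed.

Lemma sum_inv_sq (n : nat) : \sum_(1 <= a < n.+1) ((a ^ 2)%:R^-1 : rat) <= 2.
Proof.
(* The sharper bound [2 - 1 / n] for [n >= 1] is what the induction carries. *)
suff S m : \sum_(1 <= a < m.+2) ((a ^ 2)%:R^-1 : rat) <= 2 - m.+1%:R^-1.
  case: n => [|n]; first by rewrite big_geq.
  by apply: le_trans (S n) _; rewrite gerBl invr_ge0.
elim: m => [|m IH]; first by rewrite big_nat1 exp1n invr1.
rewrite big_nat_recr //=; apply: le_trans (lerD IH (lexx _)) _.
rewrite natrX -[m.+2%:R]natr1; set z : rat := m.+1%:R.
have z0 : 0 < z by rewrite ltr0n.
rewrite -subr_ge0.
have -> : 2 - (z + 1)^-1 - (2 - z^-1 + (z + 1) ^- 2) = (z * (z + 1) ^+ 2)^-1.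
  by field; rewrite !gt_eqF //; lra.
by rewrite invr_ge0 mulr_ge0 ?sqr_ge0 // ltW.
Qed.

(** Writing [n = a ^ 2 * d] with [d] squarefree, each [1 / n] occurs in the expanded product of the
    sum of [1 / a ^ 2], at most 2, and the sum of [1 / d]. *)
Lemma harmonic_le_squarefree (D : nat) :
  \sum_(1 <= n < D.+1) (n%:R^-1 : rat) <=
  2 * \sum_(1 <= d < D.+1 | squarefree d) d%:R^-1.
Proof.
apply: (@le_trans _ _ (\sum_(1 <= a < D.+1) \sum_(1 <= d < D.+1 | squarefree d)
   ((a ^ 2)%:R^-1 * d%:R^-1))); last first.
  rewrite -big_distrlr /= ler_wpM2r ?sum_inv_sq //.
  by apply: sumr_ge0 => d _; rewrite invr_ge0.
(* Every [n <= D] is represented by at least one pair [(a, d)], and every pair represents at most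
   one [n]; exchanging the sums compares the two sides. *)
pose G a d n : rat := if (n == a ^ 2 * d)%N then n%:R^-1 else 0.
have G0 a d n : 0 <= G a d n by rewrite /G; case: ifP; rewrite ?invr_ge0.
apply: (@le_trans _ _ (\sum_(1 <= n < D.+1)
    \sum_(1 <= a < D.+1) \sum_(1 <= d < D.+1 | squarefree d) G a d n)).
  rewrite big_nat [leRHS]big_nat; apply: ler_sum => n /andP[n0 nD].
  have [a [d [sd a0 d0 nE]]] := squarefree_decomp n n0.
  have aD : (a < D.+1)%N by nia.
  have dD : (d < D.+1)%N by nia.
  rewrite (bigD1_seq a) ?iota_uniq ?mem_index_iota ?a0 //=.
  rewrite -big_filter (bigD1_seq d) ?filter_uniq ?iota_uniq //=; last first.
    by rewrite mem_filter sd mem_index_iota d0.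
  rewrite {1}/G -nE eqxx -addrA lerDl addr_ge0 // sumr_ge0 // => *.
  by rewrite sumr_ge0.
rewrite exchange_big /=; apply: ler_sum => a _.
rewrite exchange_big /=; apply: ler_sum => d _.
rewrite -invfM -natrM; set m := (a ^ 2 * d)%N.
have [mD|mD] := boolP (m \in index_iota 1 D.+1).
  rewrite (bigD1_seq m) ?iota_uniq //= big1 ?addr0 => [|n nm].
    by rewrite /G eqxx.
  by rewrite /G (negPf nm).
rewrite big_seq big1 ?invr_ge0 // => n nD; rewrite /G -/m ifN //.
by apply: contraNneq mD => <-.
Qed.

(** Each dyadic block [(2 ^ m, 2 ^ m.+1]] contributes at least [1 / 2]. *)
Lemma harmonic_pow2 (m : nat) :
  (m.+1)%:R / 2 <= \sum_(1 <= n < (2 ^ m).+1) (n%:R^-1 : rat).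
Proof.
elim: m => [|m IH]; first by rewrite big_nat1.
rewrite (@big_cat_nat _ _ _ (2 ^ m).+1) //=; last by rewrite ltnS leq_exp2l.
have : 1 / 2 <= \sum_((2 ^ m).+1 <= n < (2 ^ m.+1).+1) (n%:R^-1 : rat).
  apply: (@le_trans _ _ (\sum_((2 ^ m).+1 <= n < (2 ^ m.+1).+1)
      (2 ^ m.+1)%:R^-1)).
    rewrite sumr_const_nat subSS expnS mul2n -addnn addnK -[leRHS]mulr_natr.
    rewrite natrD; set z : rat := (2 ^ m)%:R.
    have z0 : 0 < z by rewrite ltr0n expn_gt0.
    have -> // : 1 / 2 = (z + z)^-1 * z.
    by field; rewrite gt_eqF //; lra.
  rewrite big_nat [leRHS]big_nat; apply: ler_sum => n /andP[n0 nD].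
  by rewrite lef_pV2 ?ler_nat // posrE ltr0n ?expn_gt0 //; lia.
by rewrite -[m.+2%:R]natr1; lra.
Qed.

(* [h p] is [density_defect p / p]; the defects have a convergent product. *)
Definition density_defect (m : nat) : rat := m%:R * sieve_density m.

Lemma density_defect_ge0 (m : nat) : 0 <= density_defect m.
Proof.
case: m => [|m]; first by rewrite /density_defect mul0r.
by rewrite mulr_ge0 // sieve_density_ge0.
Qed.

Lemma density_defect_le1 (m : nat) : density_defect m <= 1.
Proof.
by rewrite /density_defect mulrA ler_pdivrMr ?sieve_denom_gt0 //; nra.
Qed.

(* The partial products dominate the telescoping sequence
   [n / (3 * (n - 1))]. *)
Lemma prod_density_defect (n : nat) :
  3^-1 <= \prod_(2 <= m < n.+1) density_defect m.
Proof.
suff S m : 3^-1 * (m.+2%:R / m.+1%:R) <=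
    \prod_(2 <= i < m.+3) density_defect i.
  case: n => [|[|n]]; try by rewrite big_geq.
  apply: le_trans (S n); rewrite -[leLHS]mulr1 ler_wpM2l //.
  by rewrite ler_pdivlMr ?ltr0n // mul1r ler_nat.
(* The base case is an equality, [density_defect 2 = 2 / 3], which fixes the constant [1 / 3]. *)
elim: m => [|m IH]; first by rewrite big_nat1.
rewrite big_nat_recr //=.
apply: le_trans (ler_wpM2r (density_defect_ge0 _) IH).
rewrite -mulrA ler_wpM2l // /density_defect /sieve_density.
rewrite -[m.+3%:R]natr1 -[m.+2%:R]natr1; set z : rat := m.+1%:R.
have z0 : 0 < z by rewrite ltr0n.
rewrite -subr_ge0.
have -> : (z + 1) / z * ((z + 1 + 1) * ((z + 1 + 1 - 1) /
    ((z + 1 + 1) ^+ 2 - (z + 1 + 1) + 1))) - (z + 1 + 1) / (z + 1) =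
    (z + 2) / (z * (z + 1) * ((z + 2) ^+ 2 - (z + 2) + 1)).
  by field; rewrite !gt_eqF //; nra.
by rewrite divr_ge0 ?mulr_ge0 //; nra.
Qed.

(** [d * sieve_density_prod d] is the product of the defects over the primes of [d]. All defects lie
    in [[0, 1]], so extending it to all integers from 2 to [d] only lowers it. *)
Lemma sieve_density_prod_lower (d : nat) : (0 < d)%N -> squarefree d ->
  3^-1 * d%:R^-1 <= sieve_density_prod d.
Proof.
move=> d0 sd; rewrite ler_pdivrMr ?ltr0n // mulrC.
have -> : d%:R = \prod_(p <- primes d) p%:R :> rat.
  by rewrite {1}(eqP sd) natr_prod.
rewrite -big_split /=.
apply: le_trans (prod_density_defect d) _.
have -> : \prod_(p <- primes d) (p%:R * sieve_density p) =
    \prod_(2 <= m < d.+1 | m \in primes d) density_defect m.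
  rewrite -[LHS]/(\prod_(p <- primes d) density_defect p) -[RHS]big_filter.
  apply: perm_big; apply: uniq_perm.
  - exact: primes_uniq.
  - by rewrite filter_uniq ?iota_uniq.
  move=> p; rewrite mem_filter mem_index_iota.
  have [|//] := boolP (p \in primes d); rewrite mem_primes => /and3P[pp _ pd].
  by rewrite prime_gt1 // ltnS dvdn_leq.
rewrite [leRHS]big_mkcond; apply: ler_prod => m _.
by rewrite density_defect_ge0; case: ifP => _ //=; exact: density_defect_le1.
Qed.

(** The 12 is [3 * 2 * 2]: density defects, square parts, dyadic blocks. *)
Lemma sieve_total_lower (m : nat) : (m.+1)%:R / 12 <= sieve_total (2 ^ m).
Proof.
have : 3^-1 * \sum_(1 <= d < (2 ^ m).+1 | squarefree d) d%:R^-1 <=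
    sieve_total (2 ^ m).
  rewrite mulr_sumr /sieve_total big_nat_cond [leRHS]big_nat_cond.
  by apply: ler_sum => d /andP[/andP[d0 _] sd]; exact: sieve_density_prod_lower.
have := harmonic_le_squarefree (2 ^ m); have := harmonic_pow2 m.
by lra.
Qed.

(** * Squarefull numbers among [N] consecutive integers *)

Lemma sieve_total_le (D : nat) : sieve_total D <= D%:R.
Proof.
apply: (@le_trans _ _ (\sum_(1 <= d < D.+1) 1)).
  rewrite /sieve_total big_mkcond; apply: ler_sum => d _.
  by case: ifP => // _; exact: sieve_density_prod_le1.
by rewrite sumr_const_nat subn1.
Qed.

Lemma sieve_total_ge1 (D : nat) : (0 < D)%N -> 1 <= sieve_total D.
Proof.
move=> D0; rewrite /sieve_total big_mkcond big_ltn //.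
rewrite {1}/squarefree /sieve_density_prod big_nil eqxx big_nil lerDl.
by apply: sumr_ge0 => d _; case: ifP => // _; exact: sieve_density_prod_ge0.
Qed.

(** With [H >= 1], [D ^ 6 <= D ^ 7 <= N <= H * N], so the error is at most the main term. Cancelling
    [H] leaves [c * H <= 2 * N], and [H >= m.+1 / 12] gives 24. *)
Lemma count_kfull2_interval (m a N : nat) : (2 ^ (7 * m) <= N)%N ->
  (count (kfull 2) (iota a N) * m.+1 <= 24 * N)%N.
Proof.
set D := (2 ^ m)%N => DN; rewrite -(ler_nat rat) !natrM.
have D0 : (0 < D)%N by rewrite expn_gt0.
have := sieve_bound D a N; have := sieve_total_lower m; rewrite -/D.
have := sieve_total_le D; have := sieve_total_ge1 D D0.
have {DN} : (D ^ 6)%:R * D%:R <= N%:R :> rat.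
  by rewrite -natrM ler_nat -expnSr -expnM mulnC.
set H := sieve_total D; set c : rat := (count _ _)%:R.
set n : rat := N%:R; set q : rat := D%:R; set r : rat := (D ^ 6)%:R.
set k : rat := (m.+1)%:R.
have c0 : 0 <= c by rewrite ler0n.
have r0 : 0 <= r by rewrite ler0n.
move=> rqn H1 Hq kH cH.
have rq : 0 <= r * (q - 1) by rewrite mulr_ge0 //; lra.
have Hn : 0 <= (H - 1) * n by rewrite mulr_ge0 ?ler0n //; lra.
have cHn : H * (c * H) <= H * (2 * n) by lra.
move: cHn; rewrite ler_pM2l => [cHn|]; last by lra.
have : 0 <= c * (H - k / 12) by rewrite mulr_ge0 //; lra.
by lra.
Qed.

(** * Passage to [Q] and real endpoints *)

Open Scope R_scope.

Lemma kfull_leq (j k n : nat) : (j <= k)%N -> kfull k n -> kfull j n.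
Proof.
move=> jk /andP[n0 /allP H]; apply/andP; split=> //.
apply/allP => p /H; apply: dvdn_trans.
by rewrite !Nat_powE dvdn_exp2l.
Qed.

Lemma nat_floor (x : R) : 0 <= x ->
  exists a : nat, [/\ INR a <= x, x < INR a.+1 & Z.to_nat (up x) = a.+1].
Proof.
move=> x0; have [u1 u2] := archimed x.
have U : Z.lt Z0 (up x) by apply: lt_IZR; Lra.lra.
exists (Z.to_nat (Z.pred (up x))).
have E : INR (Z.to_nat (Z.pred (up x))) = IZR (up x) - 1.
  by rewrite INR_IZR_INZ Z2Nat.id /Z.pred ?plus_IZR; [Lra.lra|lia].
by split; rewrite ?S_INR ?E; [Lra.lra|Lra.lra|lia].
Qed.

Lemma Q_floor (k : nat) (x : R) : 0 <= x ->
  exists a : nat, [/\ INR a <= x, x < INR a.+1 &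
    Q k x = count (kfull k) (iota 1 a)].
Proof.
move=> /nat_floor[a [ax xa aE]]; exists a; split=> //.
(* Since [up x] is the floor plus 1, the range in [Q] has one extra candidate [a.+1 > x], rejected
   by the test. *)
rewrite /Q aE -[a.+1]addn1 iotaD count_cat /= add1n.
case: (Rle_dec (INR a.+1) x) => [h|h] /=; first by Lra.lra.
rewrite andbF !addn0; apply: eq_in_count => n; rewrite mem_iota => /andP[_ na].
case: (Rle_dec (INR n) x) => [h1|h1] /=; first by rewrite andbT.
have : INR n <= INR a by apply: le_INR; lia.
by Lra.lra.
Qed.

Lemma INR_pow2_le_exp (n : nat) : INR (2 ^ n) <= exp (INR n).
Proof.
elim: n => [|n IH]; first by rewrite exp_0 /=; Lra.lra.
rewrite expnS mul2n -addnn plus_INR S_INR exp_plus.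
have := exp_ineq1_le 1; have := exp_pos (INR n).
by Lra.nra.
Qed.

Theorem theorem1 (k : nat) (hk : le 2 k) :
  exists C : R, 0 < C /\
    forall x y : R, 1 <= x -> 1 <= y -> y <= x ->
      INR (Q k (x + y)) - INR (Q k x) <= C * (y / ln (y + 1)).
Proof.
(* [336 = 24 * 7 * 2]: 24 from the interval count, 7 from [ln (y + 1) <= 7 * m.+1], and 2 from
   [N + 1 <= 2 * y], where [N] is the floor of [y]. *)
exists 336; split; first by Lra.lra.
move=> x y x1 y1 _.
have [|a [ax xa ->]] := Q_floor k x; first by Lra.lra.
have [|b [bx xb ->]] := Q_floor k (x + y); first by Lra.lra.
have [|N [Ny yN _]] := nat_floor y; first by Lra.lra.
move: xa xb yN; rewrite !S_INR => xa xb yN.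
have ab : (a < b.+1)%N.
  by apply/ssrnat.ltP/INR_lt; rewrite S_INR; Lra.lra.
(* The integers in [(x, x + y]] are thus among the [N.+1] integers following [a]. *)
have bN : (b < a + N.+1 + 1)%N.
  by apply/ssrnat.ltP/INR_lt; rewrite !plus_INR S_INR /=; Lra.lra.
have -> : iota 1 b = iota 1 a ++ iota a.+1 (b - a).
  by rewrite -add1n -iotaD; congr iota; lia.
rewrite count_cat plus_INR.
(* The largest [m] with [2 ^ (7 * m) <= N.+1]. *)
pose m := (trunc_log 2 N.+1 %/ 7)%N.
have /andP[lo hi] := @trunc_log_bounds 2 N.+1 isT isT.
have := count_kfull2_interval m a.+1 N.+1.
move=> /(_ (leq_trans _ lo)); rewrite leq_exp2l // mulnC leq_trunc_div.
move=> /(_ isT) cN.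
have cc : (count (kfull k) (iota a.+1 (b - a)) <=
           count (kfull 2) (iota a.+1 N.+1))%N.
  rewrite -[in leqRHS](@subnKC (b - a) N.+1); last by lia.
  rewrite iotaD count_cat; apply: leq_trans (leq_addr _ _).
  by apply: sub_count => n; apply: kfull_leq; lia.
have {cN cc} : (count (kfull k) (iota a.+1 (b - a)) * m.+1 <= 24 * N.+1)%N.
  by apply: leq_trans cN; rewrite leq_mul2r cc orbT.
set c := count _ _ => /ssrnat.leP/le_INR; rewrite !mult_INR [INR N.+1]S_INR => cN.
have ln0 : 0 < ln (y + 1) by rewrite -ln_1; apply: ln_increasing; Lra.lra.
(* By maximality of [m], [y + 1 < N + 2 <= 2 ^ (7 * m.+1) <= exp (7 * m.+1)]. *)
have lnm : ln (y + 1) <= 7 * INR m.+1.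
  apply: Rnot_lt_le => /exp_increasing; rewrite exp_ln; last by Lra.lra.
  have := INR_pow2_le_exp (7 * m.+1); rewrite mult_INR [INR 7]INR_IZR_INZ.
  have : INR N.+2 <= INR (2 ^ (7 * m.+1)).
    apply/le_INR/ssrnat.leP/(leq_trans hi); rewrite leq_exp2l // mulnC.
    exact: ltn_ceil.
  by rewrite [INR N.+2]S_INR [INR N.+1]S_INR /=; Lra.lra.
have c0 := pos_INR c.
suff : INR c * ln (y + 1) <= 336 * y.
  move=> h; apply: (Rmult_le_reg_r (ln (y + 1))) => //.
  have -> : 336 * (y / ln (y + 1)) * ln (y + 1) = 336 * y.
    by field_simplify_eq; Lra.lra.
  by Lra.lra.
have := Rmult_le_compat_l _ _ _ c0 lnm.
have e24 : INR 24 = 24 by rewrite INR_IZR_INZ.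
rewrite e24 in cN.
by Lra.lra.
Qed.
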